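(* There is a universal numerical constant $c_u>0$ such that the following holds. Let $(\mathcal{X},d)$ be a metric space with its Borel $\sigma$-algebra, let $P,Q$ be probability measures on $\mathcal{X}$, let $L>0$, $\beta\in(0,1]$, $\sigma\ge 0$, and let $n_P,n_Q\ge 0$ be integers with $n=n_P+n_Q\ge 1$. Let $(X_1,Y_1),\dots,(X_n,Y_n)$ be independent $\mathcal{X}\times\mathbb{R}$-valued random pairs, all with the same conditional distribution of $Y_i$ given $X_i$, such that $X_1,\dots,X_{n_P}\sim P$ and $X_{n_P+1},\dots,X_{n_P+n_Q}\sim Q$. Put $f^\star(x)=\mathbf{E}[Y_i\mid X_i=x]$ and $\xi_i=Y_i-f^\star(X_i)$, and assume that (1) $|f^\star(z)-f^\star(z')|\le L\,d(z,z')^\beta$ for all $z,z'\in\mathcal{X}$; (2) $\sup_x \mathbf{E}[\xi_i^2\mid X_i=x]\le\sigma^2$ for $i=1,\dots,n$. Then for every $h_n>0$, the Nadaraya–Watson estimator $\hat f$ with bandwidth $h_n$ satisfies $$\mathbf{E}\,\|\hat f-f^\star\|_{L^2(Q)}^2\le c_u\Big\{L^2h_n^{2\beta}+\frac{\|f^\star\|_\infty^2+\sigma^2}{n}\,\rho_{h_n}(\mu_n,Q)\Big\},\qquad \mu_n:=\frac{n_P}{n}P+\frac{n_Q}{n}Q.$$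
   Context: $\mathsf{B}(x,h)=\{x'\in\mathcal{X}: d(x,x')\le h\}$ is the closed ball. For probability measures $\mu,Q$ on $\mathcal{X}$ and $h>0$, the similarity measure is $\rho_h(\mu,Q)=\int_{\mathcal{X}}\frac{1}{\mu(\mathsf{B}(x,h))}\,dQ(x)\in[0,\infty]$, with $1/0=+\infty$. The Nadaraya–Watson estimator with bandwidth $h_n>0$ is defined as follows. Let $\mathcal{G}_n=\bigcup_{i=1}^n\mathsf{B}(X_i,h_n)$. Then $$\hat f(x)=\frac{\sum_{i=1}^nY_i\mathbf{1}\{X_i\in\mathsf{B}(x,h_n)\}}{\sum_{i=1}^n\mathbf{1}\{X_i\in\mathsf{B}(x,h_n)\}}\ \text{ if }x\in\mathcal{G}_n,\qquad \hat f(x)=0\ \text{ otherwise.}$$ $\|g\|_{L^2(Q)}^2=\int g^2\,dQ$, $\|f^\star\|_\infty=\sup_{x\in\mathcal X}|f^\star(x)|$ (possibly $+\infty$, in which case the bound is trivial), and the outer expectation is over the data $(X_i,Y_i)_{i=1}^n$.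
   Formalization: The formal theorem also assumes Q is carried by the closure of a countable set. This is automatic if the space is separable or no real-valued measurable cardinal exists; if one exists, the statement for arbitrary metric spaces fails. *)

(* Defs.v *)
From HB Require Import structures.
From mathcomp Require Import all_boot all_order all_algebra.
From mathcomp Require Import all_classical all_reals all_analysis.

Set Implicit Arguments.
Unset Strict Implicit.
Unset Printing Implicit Defensive.

Import Order.TTheory GRing.Theory Num.Theory.
Import numFieldNormedType.Exports.

Local Open Scope classical_set_scope.
Local Open Scope ring_scope.

(* The library's measurable types are pointed. Being pointed is no restriction
   on a space that carries a probability measure. *)
#[short(type="pmetricType")]
HB.structure Definition PMetric (K : numDomainType) :=
  { M of Metric K M & Pointed M }.

Notation borel M := (g_sigma_algebraType (@open M)).

Definition cball (R : realType) (M : metricType R) (x : M) (h : R) : set M :=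
  [set x' | mdist x x' <= h].

(* inve is the total inverse on \bar R, with 0^-1 = +oo. *)
Definition similarity (R : realType) (M : pmetricType R)
    (mu Q : {measure set (borel M) -> \bar R}) (h : R) : \bar R :=
  (\int[Q]_x (mu (cball x h))^-1)%E.

Definition mixture (R : realType) (M : pmetricType R) (nP nQ : nat)
    (P Q : {measure set (borel M) -> \bar R}) :
    {measure set (borel M) -> \bar R} :=
  measure_add (mscale (nP%:R / (nP + nQ)%:R)%:nng P)
              (mscale (nQ%:R / (nP + nQ)%:R)%:nng Q).

Definition nadaraya_watson (R : realType) (M : metricType R) (n : nat)
    (h : R) (x_ : 'I_n -> M) (y_ : 'I_n -> R) (x : M) : R :=
  if x \in \bigcup_(i in [set: 'I_n]) cball (x_ i) h then
    (\sum_(i < n) y_ i * \1_(cball x h) (x_ i)) /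
    (\sum_(i < n) \1_(cball x h) (x_ i))
  else 0.

Definition sqL2norm (R : realType) d (T : measurableType d)
    (Q : {measure set T -> \bar R}) (g : T -> R) : \bar R :=
  (\int[Q]_x ((g x) ^+ 2)%:E)%E.

Definition supnorm (R : realType) (T : Type) (g : T -> R) : \bar R :=
  ereal_sup [set `|g x|%:E | x in [set: T]].

Definition mutually_independent (R : realType) d (Omega : measurableType d)
    d' (T : measurableType d') (Pr : probability Omega R)
    (I : finType) (Z : I -> Omega -> T) : Prop :=
  forall (J : {set I}) (A : I -> set T), (forall i, measurable (A i)) ->
    Pr (\bigcap_(i in [set` J]) (Z i @^-1` A i)) =
    (\prod_(i in J) Pr (Z i @^-1` A i))%E.

Definition cond_distribution (R : realType) d (Omega : measurableType d)
    d1 (T1 : measurableType d1) d2 (T2 : measurableType d2)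
    (Pr : probability Omega R) (U : {RV Pr >-> T1}) (V : {RV Pr >-> T2})
    (k : R.-pker T1 ~> T2) : Prop :=
  forall (A : set T1) (B : set T2), measurable A -> measurable B ->
    Pr (U @^-1` A `&` V @^-1` B) =
    (\int[distribution Pr U]_(x in A) k x B)%E.

(* E[g(U, V) | U = x] when k is the conditional distribution of V given U. *)
Definition cond_expectation (R : realType) d1 (T1 : measurableType d1)
    d2 (T2 : measurableType d2) (k : R.-pker T1 ~> T2)
    (g : T1 -> T2 -> R) (x : T1) : \bar R :=
  (\int[k x]_y (g x y)%:E)%E.

(* The value is E[Y | X = x] when that is finite, and an arbitrary real number
   otherwise. A finite bound on E[(Y - f(X))^2 | X = x] for a real-valued f
   forces Y to be square integrable under k x, so it excludes the latter. *)
Definition regression (R : realType) d1 (T1 : measurableType d1)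
    (k : R.-pker T1 ~> (measurableTypeR R)) (x : T1) : R :=
  fine (cond_expectation k (fun _ y => y) x).

(* Q is carried by a closed separable set. This holds for all Q when M is
   separable. On a nonseparable M, a Q without this property exists only if
   real-valued measurable cardinals do. Such a Q can make
   {(x, x') | mdist x x' <= h} non-measurable for the product sigma-algebra,
   and the integrals over Q and over the data need not commute. *)
Definition separably_supported (R : realType) (M : pmetricType R)
    (Q : {measure set (borel M) -> \bar R}) : Prop :=
  exists2 D : set M, countable D & Q (closure D) = 1%E.

(* Main.v *)
Require Import Defs.
From HB Require Import structures.
From mathcomp Require Import all_boot all_order all_algebra.
From mathcomp Require Import all_classical all_reals all_analysis.
From mathcomp Require Import measurable_realfun ring lra.

Set Implicit Arguments.
Unset Strict Implicit.
Unset Printing Implicit Defensive.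

Import Order.TTheory GRing.Theory Num.Theory.
Import numFieldNormedType.Exports.

Local Open Scope classical_set_scope.
Local Open Scope ring_scope.

(** By Tonelli it suffices to bound the risk at each point [x] of a closed
    separable set carrying [Q]. Let [S] be the random set of the indices [i]
    with [X_i] in the ball [B] of radius [h] around [x]. On the event that [S]
    is a given nonempty set, the error at [x] is the average over [S] of the
    residuals [Y_i - f (X_i)] plus a bias of at most [L h^beta]; independence
    kills the cross terms, so the squared average contributes at most
    [sigma^2 P(S) / #|S|]. If [S] is empty the squared error is [f(x)^2].
    Both [1/#|S|] and the indicator of emptiness are at most [2/(#|S|+1)], and
    [#|S|] is a sum of pairwise independent indicators with mean
    [a = n mu_n(B)] and variance at most [a], whence
    [E[1/(#|S|+1)] <= 2/(a+1)]. *)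

(** * Integration and independence *)

(** The integral of a nonnegative function, measurable or not, is a supremum over the simple
    functions below it, hence monotone. This serves for integrands whose measurability is not
    established, such as the squared L2(Q) error as a function of the sample. *)
Lemma ge0_le_integralT d (T : measurableType d) (R : realType)
    (mu : {measure set T -> \bar R}) (f g : T -> \bar R) :
  (forall x, 0 <= f x)%E -> (forall x, f x <= g x)%E ->
  (\int[mu]_x f x <= \int[mu]_x g x)%E.
Proof.
move=> f0 fg; have g0 x : (0 <= g x)%E by exact: le_trans (f0 x) (fg x).
rewrite !ge0_integralTE//; apply: ge_ereal_sup => _ [h /= hf <-].
apply: ereal_sup_ubound; exists h => //= x; exact: le_trans (hf x) (fg x).
Qed.

(** The weights [w] are the law of a random subset of [I] in which membership of [i] has probability
    [p i] and memberships are pairwise independent. Two moments of the cardinality m suffice, since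
    1/(m+1) lies below a parabola tangent to it at the mean. *)
Lemma reciprocal_moment_le (R : realFieldType) (I : finType) (w : {set I} -> R)
    (p : I -> R) :
  (forall S, 0 <= w S) -> \sum_S w S = 1 ->
  (forall i, \sum_(S : {set I} | i \in S) w S = p i) ->
  (forall i j, i != j ->
     \sum_(S : {set I} | (i \in S) && (j \in S)) w S = p i * p j) ->
  \sum_S w S / #|S|.+1%:R <= 2 / (1 + \sum_i p i).
Proof.
move=> w0 w1 wp wpp; set a := \sum_i p i.
have p0 i : 0 <= p i by rewrite -wp sumr_ge0.
have a0 : 0 <= a by rewrite sumr_ge0.
have cardE (S : {set I}) : #|S|%:R = \sum_(i : I) (i \in S)%:R :> R.
  rewrite -sum1_card natr_sum big_mkcond/=.
  by apply: eq_bigr => i _; case: (i \in S).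
have m1 : \sum_S w S * #|S|%:R = a.
  under eq_bigr do rewrite cardE mulr_sumr.
  rewrite exchange_big/=; apply: eq_bigr => i _; rewrite -wp [RHS]big_mkcond/=.
  by apply: eq_bigr => S _; case: (i \in S); rewrite ?mulr1 ?mulr0.
have m2 : \sum_S w S * #|S|%:R ^+ 2 <= a ^+ 2 + a.
  have -> : \sum_S w S * #|S|%:R ^+ 2 =
      \sum_i \sum_j \sum_(S : {set I} | (i \in S) && (j \in S)) w S.
    under eq_bigr do rewrite cardE expr2 mulr_suml mulr_sumr.
    rewrite exchange_big/=; apply: eq_bigr => i _.
    under eq_bigr do rewrite !mulr_sumr.
    rewrite exchange_big/=; apply: eq_bigr => j _; rewrite [RHS]big_mkcond/=.
    by apply: eq_bigr => S _; case: (i \in S); case: (j \in S);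
      rewrite /= ?(mulr1, mulr0, mul0r).
  have -> : a ^+ 2 + a = \sum_i (p i * a + p i).
    by rewrite big_split/= -mulr_suml expr2.
  (* The term j = i gives [p i]. The others give [p i * p j], and adding the nonnegative [p i * p i]
     completes them to [p i * a]. *)
  apply: ler_sum => i _; rewrite (bigD1 i)//=.
  under eq_bigl do rewrite andbb.
  rewrite wp [leRHS]addrC lerD2l {1}/a [in leRHS](bigD1 i)//= mulrDr mulr_sumr.
  rewrite -[leLHS]add0r lerD ?mulr_ge0//.
  by apply: ler_sum => j ji; rewrite wpp// eq_sym.
clearbody a; have a1 : 0 < 1 + a by lra.
pose c := (1 + a)^-1.
(* The tangent parabola at [m = a]:
   1/(m+1) = c - (m-a) c^2 + (m-a)^2 c^2 / (m+1). *)
have key (S : {set I}) : w S / #|S|.+1%:R <=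
    w S * (c - (#|S|%:R - a) * c ^+ 2 + (#|S|%:R - a) ^+ 2 * c ^+ 2).
  apply: ler_wpM2l => //; rewrite -natr1; set m := #|S|%:R : R.
  have m0 : 0 <= m by rewrite ler0n.
  have -> : (m + 1)^-1 =
      c - (m - a) * c ^+ 2 + (m - a) ^+ 2 * c ^+ 2 / (m + 1).
    by rewrite /c; field; apply/andP; split; apply/eqP; lra.
  rewrite lerD2l; apply: ler_piMr; first by rewrite mulr_ge0 ?sqr_ge0.
  by rewrite invf_le1; lra.
apply: le_trans (ler_sum _ (fun S _ => key S)) _.
have -> : \sum_S w S * (c - (#|S|%:R - a) * c ^+ 2 + (#|S|%:R - a) ^+ 2 * c ^+ 2)
   = (c + a * c ^+ 2 + a ^+ 2 * c ^+ 2) * \sum_S w S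
     - (c ^+ 2 + 2 * a * c ^+ 2) * (\sum_S w S * #|S|%:R)
     + c ^+ 2 * (\sum_S w S * #|S|%:R ^+ 2).
  rewrite !mulr_sumr -sumrB -big_split/=; apply: eq_bigr => S _; ring.
rewrite w1 m1.
have c0 : 0 <= c ^+ 2 by rewrite sqr_ge0.
have := ler_wpM2l c0 m2.
have ac : a * c = 1 - c by rewrite /c; field; apply/eqP; lra.
have -> : 2 / (1 + a) = 2 * c by [].
have cc : 0 <= c by rewrite invr_ge0 ltW.
have a2c : a * c ^+ 2 <= c by rewrite expr2 mulrA ac mulrBl mul1r gerBl mulr_ge0.
(* The left side is [c + c ^+ 2 * (q - a ^+ 2)], where [q - a ^+ 2] is the variance of the
   cardinality and is at most [a]; hence it is at most [c + a * c ^+ 2 <= 2 * c]. *)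
move: a2c; set q := \sum_S _; nra.
Qed.

(** By independence the joint law of [f] and [g] is the product of their laws, and Fubini factors
    the integral of [z.1 * z.2] against that product. *)
Lemma integral_indepM d (T : measurableType d) (R : realType)
    (P : probability T R) (f g : T -> R) :
  measurable_fun setT f -> measurable_fun setT g ->
  (forall C D, measurable C -> measurable D ->
    P (f @^-1` C `&` g @^-1` D) = P (f @^-1` C) * P (g @^-1` D))%E ->
  P.-integrable setT (EFin \o f) -> P.-integrable setT (EFin \o g) ->
  P.-integrable setT (fun w => (f w * g w)%:E) /\
  (\int[P]_w (f w * g w)%:E = \int[P]_w (f w)%:E * \int[P]_w (g w)%:E)%E.
Proof.
move=> mf mg fg intf intg.
have mh : measurable_fun setT (fun w => (f w, g w)).
  by apply: measurable_fun_pair.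
pose h : {mfun T >-> (R * R)%type} := mfun_Sub (mem_set mh).
pose f' : {mfun T >-> R} := mfun_Sub (mem_set mf).
pose g' : {mfun T >-> R} := mfun_Sub (mem_set mg).
pose m1 : probability _ R := distribution P f'.
pose m2 : probability _ R := distribution P g'.
pose RR : measurableType _ := (R * R)%type.
pose M (z : RR) : \bar R := (z.1 * z.2)%:E.
have jointE A : measurable A -> (m1 \x m2)%E A = distribution P h A.
  move=> mA; apply: product_measure_unique => // C D mC mD; exact: fg.
have mM : measurable_fun [set: RR] M.
  by apply/measurable_EFinP; apply: measurable_funM.
have mid : measurable_fun setT (EFin : R -> \bar R) by exact/measurable_EFinP.
have if1 : m1.-integrable setT (EFin : R -> \bar R).
  by apply: integrable_pushforward => //; rewrite preimage_setT.
have ig1 : m2.-integrable setT (EFin : R -> \bar R).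
  by apply: integrable_pushforward => //; rewrite preimage_setT.
have iM : (m1 \x m2)%E.-integrable setT M.
  apply/integrable12ltyP => //=.
  under eq_integral => x _.
    under eq_integral => y _ do rewrite normrM EFinM.
    rewrite ge0_integralZl_EFin//; first over.
    by apply/measurable_EFinP; exact: normr_measurable.
  rewrite ge0_integralZr//; last by apply: integral_ge0.
    apply: lte_mul_pinfty; [exact: integral_ge0| |].
      apply: integrable_fin_num => //; exact: (integrable_abse if1).
    by case/integrableP : ig1.
  by apply/measurable_EFinP; exact: normr_measurable.
have maM : measurable_fun [set: RR] (abse \o M) by apply: measurableT_comp.
have mMh : measurable_fun setT (M \o h).
  exact: (@measurableT_comp _ _ _ T RR (\bar R) M setT h mM mh).
have iM' : P.-integrable setT (M \o h).
  apply/integrableP; split => //.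
  have <- : (\int[distribution P h]_z (abse \o M) z =
      \int[P]_w `|(M \o h) w|)%E.
    by apply: (@ge0_integral_distribution _ _ T RR R P h _ maM) => y; exact: abse_ge0.
  rewrite (eq_measure_integral (m1 \x m2)%E); last by move=> A mA _; exact/esym/jointE.
  by case/integrableP: iM.
split=> //.
transitivity (\int[distribution P h]_z M z)%E.
  by rewrite integral_distribution.
rewrite (eq_measure_integral (m1 \x m2)%E); last by move=> A mA _; exact/esym/jointE.
rewrite -integral12_prod_meas1// /fubini_F/=.
under eq_integral => x _.
  under eq_integral => y _ do rewrite /M/= EFinM.
  rewrite integralZl//; over.
have fin2 := integrable_fin_num measurableT ig1.
rewrite -(fineK fin2) integralZr// fineK//.
by rewrite !integral_distribution.
Qed.

(** * Disintegration along a conditional distribution *)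

Section graph_kernel.
Context d1 d2 (T1 : measurableType d1) (T2 : measurableType d2) (R : realType).
Variable k : R.-pker T1 ~> T2.

(* Unification does not find the measurability proof that the canonical measure
   structure of [pushforward] depends on, so the structure is given by name. *)
Definition graph_kernel (z : unit * T1) : {measure set (T1 * T2) -> \bar R} :=
  measure_function_pushforward__canonical__measure_function_Measure (k z.2)
    (pair1_measurable z.2).

Let measurable_graph_kernel (U : set (T1 * T2)) :
  measurable U -> measurable_fun [set: unit * T1] (graph_kernel ^~ U).
Proof.
move=> mU.
have mk := @measurable_fun_xsection_finite_kernel _ _ _ _ R k U (mem_set mU).
have := @measurableT_comp _ _ _ _ _ _ _ setT _ mk (@measurable_snd _ _ unit T1).
by under eq_fun do rewrite /= xsectionE.
Qed.

HB.instance Definition _ :=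
  isKernel.Build _ _ (unit * T1)%type (T1 * T2)%type R graph_kernel
    measurable_graph_kernel.

Let graph_kernel_prob z : graph_kernel z setT = 1%E.
Proof. by rewrite /graph_kernel/= /pushforward preimage_setT prob_kernel. Qed.

HB.instance Definition _ :=
  Kernel_isProbability.Build _ _ (unit * T1)%type (T1 * T2)%type R graph_kernel
    graph_kernel_prob.

End graph_kernel.

(** The law of [(U, V)] and the composition of the law of [U] with [graph_kernel k] agree on
    rectangles, which form a pi-system generating the product sigma-algebra, so they are equal.
    Integration against a composed kernel is iterated integration. *)
Lemma ge0_integral_cond_distribution d d1 d2 (Omega : measurableType d)
    (T1 : measurableType d1) (T2 : measurableType d2) (R : realType)
    (Pr : probability Omega R) (U : {RV Pr >-> T1}) (V : {RV Pr >-> T2})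
    (k : R.-pker T1 ~> T2) (g : T1 * T2 -> \bar R) :
  (forall A B, measurable A -> measurable B ->
    Pr (U @^-1` A `&` V @^-1` B) = \int[distribution Pr U]_(x in A) k x B)%E ->
  (forall z, 0 <= g z)%E -> measurable_fun [set: T1 * T2] g ->
  (\int[Pr]_w g (U w, V w) =
   \int[distribution Pr U]_x \int[k x]_y g (x, y))%E.
Proof.
move=> UV g0 mg.
have mUV : measurable_fun setT (fun w => (U w, V w)) by exact: measurable_fun_pair.
pose W : {mfun Omega >-> (T1 * T2)%type} := mfun_Sub (mem_set mUV).
(* The law of [U] is recast as a constant kernel from [unit], so that [kcomp] can compose it with
   [graph_kernel k]. *)
pose K := kprobability
  (@measurable_cst _ _ unit _ setT (distribution Pr U : pprobability _ _)).
have jointE A : measurable A -> distribution Pr W A = kcomp K (graph_kernel k) tt A.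
  pose C : set (set (T1 * T2)) :=
    [set A `*` B | A in measurable & B in measurable].
  have CI : setI_closed C.
    move=> _ _ [A1 mA1 [B1 mB1 <-]] [A2 mA2 [B2 mB2 <-]]; rewrite -setXI.
    exists (A1 `&` A2); first exact: measurableI.
    by exists (B1 `&` B2) => //; exact: measurableI.
  apply: (measure_unique C (fun=> setT)) => //.
  - by rewrite measurable_prod_measurableType.
  - by move=> _; exists setT => //; exists setT => //; rewrite setXTT.
  - exact: bigcup_const.
  - move=> _ [B mB [D mD <-]].
    transitivity (Pr (U @^-1` B `&` V @^-1` D)) => //.
    rewrite UV// integral_mkcond; apply: eq_integral => x _.
    rewrite patchE; case: ifPn => xB; rewrite /= /pushforward.
      by congr (k x _); apply/seteqP; split => y /=; [split => //; exact: set_mem|case].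
    rewrite [X in k x X](_ : _ = set0) ?measure0//.
    by rewrite -subset0 => y [] /= /mem_set; rewrite (negbTE xB).
  - move=> _; rewrite /= /distribution /pushforward preimage_setT.
    by rewrite probability_setT ltry.
transitivity (\int[distribution Pr W]_z g z)%E.
  by rewrite ge0_integral_distribution.
transitivity (\int[kcomp K (graph_kernel k) tt]_z g z)%E.
  by apply: eq_measure_integral => A mA _; exact: jointE.
rewrite integral_kcomp//.
apply: eq_integral => x _.
by rewrite ge0_integral_pushforward//; exact: pair1_measurable.
Qed.

(** * Residuals of the regression function *)

(** Since |t| <= 1 + t^2, a finite second moment about a real number makes [y - regression k x], and
    with it [y], integrable. Only then is [regression k x], defined through [fine], known to be the
    true mean. *)
Lemma regression_centered d1 (T1 : measurableType d1) (R : realType)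
    (k : R.-pker T1 ~> measurableTypeR R) (x : T1) :
  (\int[k x]_y ((y - regression k x) ^+ 2)%:E < +oo)%E ->
  (k x).-integrable setT (fun y => (y - regression k x)%:E) /\
  (\int[k x]_y (y - regression k x)%:E = 0)%E.
Proof.
set c := regression k x => c2.
have finE r : (\int[k x]__ r%:E = r%:E)%E.
  by rewrite integral_cst// [k x _]prob_kernel mule1.
have icst (r : R) : (k x).-integrable setT (fun=> r%:E).
  by apply/integrableP; split => //; rewrite finE ltry.
have mid : measurable_fun setT (fun y : measurableTypeR R => (y - c)%R).
  by apply: measurable_funB => //; exact: measurable_id.
have m2 : measurable_fun setT (fun y : measurableTypeR R => ((y - c) ^+ 2)%R).
  exact: measurable_funX.
have i2 : (k x).-integrable setT (fun y => ((y - c) ^+ 2)%:E).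
  apply/integrableP; split; first exact/measurable_EFinP.
  by under eq_integral do rewrite gee0_abs ?lee_fin ?sqr_ge0//.
have ic : (k x).-integrable setT (fun y => (y - c)%:E).
  apply: (le_integrable measurableT _ _ (integrableD measurableT (icst 1) i2)).
    exact/measurable_EFinP.
  move=> y _ /=; rewrite lee_fin [leRHS]ger0_norm ?addr_ge0 ?sqr_ge0//.
  rewrite -(real_normK (num_real (y - c))).
  by move: `|y - c| (normr_ge0 (y - c)) => t t0; nra.
split => //.
have iy : (k x).-integrable setT (fun y : measurableTypeR R => y%:E).
  apply: eq_integrable (integrableD measurableT ic (icst c)) => //.
  by move=> y _; rewrite /= -EFinD subrK.
transitivity (\int[k x]_y (y%:E - c%:E))%E; first exact: eq_integral.
rewrite integralB// finE /c /regression /cond_expectation fineK ?subee//;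
  exact: integrable_fin_num.
Qed.

Section residual.
Context d d1 (Omega : measurableType d) (T1 : measurableType d1) (R : realType).
Variables (Pr : probability Omega R) (U : {RV Pr >-> T1}).
Variables (V : {RV Pr >-> measurableTypeR R}) (k : R.-pker T1 ~> measurableTypeR R).
Hypothesis UVk : cond_distribution U V k.
Let f : T1 -> R := regression k.
Hypothesis mf : measurable_fun setT f.
Variables (s : R).
Hypothesis s_ge : forall x, (\int[k x]_y (((y : R) - f x) ^+ 2)%:E <= s%:E)%E.
Variable (B : set T1).
Hypothesis mB : measurable B.

Let TV : measurableType _ := (T1 * measurableTypeR R)%type.
Let r (z : TV) : R := (z.2 - f z.1) * \1_B z.1.

Let mr : measurable_fun [set: TV] r.
Proof.
apply: measurable_funM.
  apply: measurable_funB; first exact: measurable_snd.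
  by apply: measurableT_comp mf _; exact: measurable_fst.
apply: (@measurableT_comp _ _ _ TV T1 R (\1_B : T1 -> R) setT fst).
  exact: measurable_indic.
exact: measurable_fst.
Qed.

Let mUV : measurable_fun [set: Omega] (fun w => (U w, V w) : TV).
Proof. by apply: measurable_fun_pair. Qed.

Let indicX (b : bool) : b%:R ^+ 2 = b%:R :> R.
Proof. by case: b; rewrite ?expr1n ?expr0n. Qed.

(** Conditioning on [U] leaves a conditional second moment, at most [s], times the indicator of
    [B]. *)
Lemma integral_sqr_residual_le :
  (\int[Pr]_w (((V w - f (U w)) ^+ 2 * \1_B (U w))%R)%:E <=
   s%:E * Pr (U @^-1` B))%E.
Proof.
have mr2 : measurable_fun [set: TV] (fun z => (r z ^+ 2)%:E).
  by apply/measurable_EFinP; exact: measurable_funX.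
have := @ge0_integral_cond_distribution _ _ _ _ T1 (measurableTypeR R) R Pr U V
  k _ UVk (fun z => _) mr2.
move=> /(_ (fun z => ltac:(by rewrite lee_fin sqr_ge0))).
under eq_integral do rewrite /r/= exprMn indicE indicX -indicE.
move=> ->.
have s0 : 0 <= s.
  rewrite -lee_fin (le_trans _ (s_ge point))//.
  by apply: integral_ge0 => y _; rewrite lee_fin sqr_ge0.
have -> : (s%:E * Pr (U @^-1` B) = \int[distribution Pr U]_x (s * \1_B x)%:E)%E.
  under eq_integral do rewrite EFinM.
  rewrite ge0_integralZl_EFin//; last exact/measurable_EFinP.
  by rewrite integral_indic// setIT.
apply: ge0_le_integralT => x.
  by apply: integral_ge0 => y _; rewrite lee_fin sqr_ge0.
have [xB|xB] := boolP (x \in B).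
  under eq_integral do rewrite /r/= exprMn indicE xB mulr1n expr1n mulr1.
  by rewrite indicE xB mulr1; exact: s_ge.
under eq_integral do rewrite /r/= exprMn indicE (negbTE xB) mulr0n expr0n mulr0.
by rewrite integral0 indicE (negbTE xB) mulr0.
Qed.

Lemma measurable_residual :
  measurable_fun setT (fun w => (V w - f (U w)) * \1_B (U w)).
Proof. exact: (@measurableT_comp _ _ _ Omega TV R r setT _ mr mUV). Qed.

Lemma integrable_sqr_residual :
  Pr.-integrable setT (fun w => ((V w - f (U w)) ^+ 2 * \1_B (U w))%:E).
Proof.
have rE w : (V w - f (U w)) ^+ 2 * \1_B (U w) =
    ((V w - f (U w)) * \1_B (U w)) ^+ 2 by rewrite exprMn indicE indicX.
apply/integrableP; split.
  under eq_fun do rewrite rE.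
  by apply/measurable_EFinP; apply: measurable_funX; exact: measurable_residual.
under eq_integral do rewrite gee0_abs ?rE ?lee_fin ?sqr_ge0// -rE.
apply: le_lt_trans integral_sqr_residual_le _.
have mUB : measurable (U @^-1` B) by exact: measurable_funPTI.
by rewrite ltey_eq fin_numM// fin_num_measure.
Qed.

Lemma integrable_residual :
  Pr.-integrable setT (fun w => ((V w - f (U w)) * \1_B (U w))%:E).
Proof.
have i1 : Pr.-integrable setT (fun=> 1%:E) by exact: finite_measure_integrable_cst.
apply: (le_integrable measurableT _ _
  (integrableD measurableT i1 integrable_sqr_residual)).
  exact/measurable_EFinP/measurable_residual.
move=> w _ /=; rewrite lee_fin normrM indicE.
have [_|_] := boolP (U w \in B); rewrite /= ?normr0 ?mulr0// normr1 !mulr1.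
rewrite [leRHS]ger0_norm ?addr_ge0 ?sqr_ge0// -(real_normK (num_real (V w - _))).
by move: `|_ - _| (normr_ge0 (V w - f (U w))) => t t0; nra.
Qed.

(** The disintegration formula is stated for nonnegative integrands, so it is applied to the
    positive and the negative part separately. Under each [k x] the two have the same finite
    integral, because the residual is centered there. *)
Lemma integral_residual_eq0 :
  (\int[Pr]_w ((V w - f (U w)) * \1_B (U w))%:E = 0)%E.
Proof.
pose G (z : TV) : \bar R := (r z)%:E.
have mG : measurable_fun [set: TV] G by exact/measurable_EFinP.
pose UV w : TV := (U w, V w).
have parts x : (\int[k x]_y G^\+ (x, y) = \int[k x]_y G^\- (x, y))%E.
  have [ir r0] : (k x).-integrable setT (G \o pair x) /\
      (\int[k x]_y (G \o pair x) y = 0)%E.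
    have [|i0 e0] := @regression_centered _ _ _ k x.
      exact: le_lt_trans (s_ge x) (ltry _).
    have GxE y : (G \o pair x) y = ((\1_B x)%:E * (y - f x)%:E)%E.
      by rewrite -EFinM mulrC.
    split.
      apply: eq_integrable (integrableZl measurableT (\1_B x) i0) => //.
    under eq_integral do rewrite GxE.
    by rewrite integralZl// e0 mule0.
  have fp := integrable_pos_fin_num measurableT ir.
  have fn := integrable_neg_fin_num measurableT ir.
  move: r0; rewrite integralE; rewrite funepos_comp funeneg_comp in fp fn *.
  move=> /eqP.
  by rewrite sube_eq ?fin_num_adde_defl// add0e => /eqP.
have cond (g : TV -> \bar R) : (forall z, 0 <= g z)%E ->
    measurable_fun [set: TV] g ->
    (\int[Pr]_w (g \o UV) w = \int[distribution Pr U]_x \int[k x]_y g (x, y))%E.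
  by move=> g0 mg; exact: ge0_integral_cond_distribution.
have iG : Pr.-integrable setT (G \o UV) := integrable_residual.
have fn := integrable_neg_fin_num measurableT iG.
transitivity (\int[Pr]_w (G \o UV) w)%E; first by [].
rewrite integralE; rewrite funepos_comp funeneg_comp in fn *.
rewrite cond//; last exact: measurable_funepos.
rewrite (eq_integral _ _ (fun x _ => parts x)).
by rewrite -cond ?subee//; exact: measurable_funeneg.
Qed.

End residual.

(** * The random set of sample points in a fixed set *)

(** Compare the product formula over all indices, with [D] in place of [A j], with the one over the
    indices other than [j]. *)
Lemma mutually_independent_others d (Omega : measurableType d)
    d' (T : measurableType d') (R : realType) (Pr : probability Omega R)
    (I : finType) (Z : I -> Omega -> T) :
  mutually_independent Pr Z ->
  forall (j : I) (A : I -> set T) (D : set T),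
  (forall i, measurable (A i)) -> measurable D ->
  (Pr (\bigcap_(i in [set i | i != j]) (Z i @^-1` A i) `&` Z j @^-1` D) =
   Pr (\bigcap_(i in [set i | i != j]) (Z i @^-1` A i)) * Pr (Z j @^-1` D))%E.
Proof.
move=> ind j A D mA mD.
pose A' i := if i == j then D else A i.
have mA' i : measurable (A' i) by rewrite /A'; case: ifP.
have e1 := ind (finset.setC (finset.set1 j)) A mA.
have e2 := ind (finset.setTfor I) A' mA'.
have -> : \bigcap_(i in [set i | i != j]) (Z i @^-1` A i) `&` Z j @^-1` D =
    \bigcap_(i in [set` finset.setTfor I]) (Z i @^-1` A' i).
  apply/seteqP; split => w /=.
    move=> [wA wD] i _; rewrite /A'; case: eqVneq => [->//|ij]; exact: wA.
  move=> wA; split=> [i /= ij|].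
    by have := wA i; rewrite /A' (negbTE ij); apply; rewrite /= finset.inE.
  by have := wA j; rewrite /A' eqxx; apply; rewrite /= finset.inE.
rewrite e2 (bigD1 j) ?finset.inE//= {1}/A' eqxx muleC; congr (_ * _)%E.
have -> : \bigcap_(i in [set i | i != j]) (Z i @^-1` A i) =
    \bigcap_(i in [set` finset.setC (finset.set1 j)]) (Z i @^-1` A i).
  by congr (\bigcap_(i in _) _); apply/seteqP; split => i /=; rewrite !finset.inE.
rewrite e1; apply: eq_big => i; rewrite ?finset.inE// => /andP[_ ij].
by rewrite /A' (negbTE ij).
Qed.

(** If 0 is not in [C], the preimage of [C] lies inside [A] and the hypothesis applies directly. If
    0 is in [C], its complement has that form, and independence passes to complements. *)
Lemma indep_indic_preimage d (Omega : measurableType d) (R : realType)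
    (Pr : probability Omega R) (A F : set Omega) (u : Omega -> R) :
  measurable A -> measurable F -> measurable_fun setT u ->
  (forall C, measurable C ->
    Pr (A `&` u @^-1` C `&` F) = Pr (A `&` u @^-1` C) * Pr F)%E ->
  forall C, measurable C ->
  (Pr ((fun w => (\1_A w * u w)%R) @^-1` C `&` F) =
   Pr ((fun w => (\1_A w * u w)%R) @^-1` C) * Pr F)%E.
Proof.
move=> mA mF mu H C mC.
have mAu : measurable_fun setT (fun w => \1_A w * u w) by exact: measurable_funM.
have away C' : ~ C' 0 -> (fun w => \1_A w * u w) @^-1` C' = A `&` u @^-1` C'.
  move=> C0; apply/seteqP; split => w /=; rewrite indicE.
    have [/set_mem wA|_] := boolP (w \in A); first by rewrite mul1r.
    by rewrite mul0r => /C0.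
  by move=> [/mem_set -> ]; rewrite mul1r.
have [C0|C0] := pselect (C 0); last by rewrite away// H.
set E := _ @^-1` C.
have mE : measurable E by rewrite -[E]setTI; exact: mAu.
have EC : ~` E = A `&` u @^-1` (~` C) by rewrite -away//; apply: contrapT.
have HEc : (Pr (~` E `&` F) = Pr (~` E) * Pr F)%E.
  by rewrite EC H//; exact: measurableC.
have : (Pr F = Pr (~` E `&` F) + Pr (E `&` F))%E.
  by rewrite (setIC _ F) -setDE (setIC E); exact: measureDI.
rewrite HEc.
have -> : (Pr (~` E) = 1 - Pr E)%E by rewrite probability_setC.
have finP B : measurable B -> Pr B = (fine (Pr B))%:E.
  by move=> mB; rewrite fineK// fin_num_measure.
rewrite (finP E)// (finP F)// (finP (E `&` F)); last exact: measurableI.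
by rewrite -!(EFinM, EFinB, EFinD) => -[?]; congr EFin; lra.
Qed.

Section sample.
Context d d1 (Omega : measurableType d) (T1 : measurableType d1) (R : realType).
Variables (Pr : probability Omega R) (N : finType) (U : N -> {RV Pr >-> T1}).
Variables (V : N -> {RV Pr >-> measurableTypeR R}).
Variable (k : R.-pker T1 ~> measurableTypeR R).
Hypothesis indUV : mutually_independent Pr (fun i w => (U i w, V i w)).
Hypothesis UVk : forall i, cond_distribution (U i) (V i) k.
Let f : T1 -> R := regression k.
Hypothesis mf : measurable_fun setT f.
Variables (s : R).
Hypothesis s_ge : forall x, (\int[k x]_y (((y : R) - f x) ^+ 2)%:E <= s%:E)%E.
Variable (B : set T1).
Hypothesis mB : measurable B.

Definition hits (w : Omega) : {set N} := finset.finset (fun i => U i w \in B).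

Let side (S : {set N}) i : set T1 := if i \in S then B else ~` B.

Let mside S i : measurable (side S i).
Proof. by rewrite /side; case: ifP => // _; exact: measurableC. Qed.

(** The part of the event [hits = S] that is decided by the indices other than [j], and is therefore
    independent of the pair [(U j, V j)]. *)
Let others (S : {set N}) j := \bigcap_(i in [set i | i != j]) (U i @^-1` side S i).

Let hitsE S : hits @^-1` [set S] = \bigcap_(i in [set: N]) (U i @^-1` side S i).
Proof.
apply/seteqP; split => w /=.
  move=> <- i _ /=; rewrite /side finset.inE.
  by have [/set_mem//|/negP + /mem_set] := boolP (U i w \in B).
move=> wS; apply/finset.setP => i; rewrite finset.inE.
have := wS i I; rewrite /= /side.
by case: ifP => _ h; [exact: mem_set|apply/negP => /set_mem].
Qed.

Lemma measurable_hits S : measurable (hits @^-1` [set S]).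
Proof.
rewrite hitsE; apply: fin_bigcap_measurable => // i _.
exact: measurable_funPTI.
Qed.

Let measurable_others S j : measurable (others S j).
Proof.
apply: fin_bigcap_measurable => [|i _]; last exact: measurable_funPTI.
exact: (finite_finpred [pred i | i != j]).
Qed.

Let hits_others (S : {set N}) j : j \in S ->
  hits @^-1` [set S] = others S j `&` U j @^-1` B.
Proof.
move=> jS; rewrite hitsE; apply/seteqP; split => w /=.
  by move=> h; split=> [i _|]; [exact: h|have := h j I; rewrite /= /side jS].
move=> [h Bj] i _; have [->|ij] := eqVneq i j; first by rewrite /= /side jS.
exact: h.
Qed.

Let TV : measurableType _ := (T1 * measurableTypeR R)%type.
Let Z i w : TV := (U i w, V i w).

Let mZ i : measurable_fun setT (Z i).
Proof. by apply: measurable_fun_pair. Qed.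

Let others_indep S j (A : N -> set TV) (D : set TV) :
  (forall i, measurable (A i)) -> measurable D ->
  let G := others S j `&` \bigcap_(i in [set i | i != j]) (Z i @^-1` A i) in
  (Pr (G `&` Z j @^-1` D) = Pr G * Pr (Z j @^-1` D))%E.
Proof.
move=> mA mD G.
pose A' i := (side S i `*` setT) `&` A i.
have mA' i : measurable (A' i) by apply: measurableI => //; exact: measurableX.
have -> : G = \bigcap_(i in [set i | i != j]) (Z i @^-1` A' i).
  apply/seteqP; split => w /=.
    by move=> [h1 h2] i ij; split; [split => //; exact: h1|exact: h2].
  by move=> h; split => i ij; have [[]] := h i ij.
exact: (mutually_independent_others indUV).
Qed.

Let xi i w : R := V i w - f (U i w).

Let md : measurable_fun [set: TV] (fun z => z.2 - f z.1 : R).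
Proof.
apply: measurable_funB; first exact: measurable_snd.
by apply: measurableT_comp mf _; exact: measurable_fst.
Qed.

Let mxi i : measurable_fun setT (xi i).
Proof. exact: (@measurableT_comp _ _ _ Omega TV R _ setT _ md (mZ i)). Qed.

Let m1B : measurable_fun [set: TV] (fun z => \1_B z.1 : R).
Proof.
apply: (@measurableT_comp _ _ _ TV T1 R (\1_B : T1 -> R) setT fst).
  exact: measurable_indic.
exact: measurable_fst.
Qed.

Let mr : measurable_fun [set: TV] (fun z => (z.2 - f z.1) * \1_B z.1 : R).
Proof. exact: measurable_funM. Qed.

Let mr2 : measurable_fun [set: TV] (fun z => (z.2 - f z.1) ^+ 2 * \1_B z.1 : R).
Proof. by apply: measurable_funM => //; exact: measurable_funX. Qed.

(** On [hits = S] both residuals may be cut off to [B]. The event then splits off its condition on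
    [j]: one factor is the cut-off residual of [j], which is centered, and the other depends only on
    the remaining indices. *)
Lemma integral_hits_cross (S : {set N}) i j : i \in S -> j \in S -> i != j ->
  Pr.-integrable setT (fun w => (\1_(hits @^-1` [set S]) w * (xi i w * xi j w))%:E) /\
  (\int[Pr]_w (\1_(hits @^-1` [set S]) w * (xi i w * xi j w))%:E = 0)%E.
Proof.
move=> iS jS ij.
pose u w := xi i w * \1_B (U i w).
pose v w := xi j w * \1_B (U j w).
have -> : (fun w => (\1_(hits @^-1` [set S]) w * (xi i w * xi j w))%:E) =
    fun w => (\1_(others S j) w * u w * v w)%:E.
  apply/funext => w; congr EFin; rewrite (hits_others jS) /u /v !indicE in_setI.
  have [/set_mem/(_ i ij)|] := boolP (w \in others S j); last by rewrite !mul0r.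
  rewrite /side/= iS => /mem_set ->; rewrite -[w \in _ @^-1` _]/(U j w \in B).
  by case: (U j w \in B); rewrite !(mul1r, mulr1, mul0r, mulr0).
have mu : measurable_fun setT u.
  exact: (@measurableT_comp _ _ _ Omega TV R _ setT _ mr (mZ i)).
have mv : measurable_fun setT v.
  exact: (@measurableT_comp _ _ _ Omega TV R _ setT _ mr (mZ j)).
have iu : Pr.-integrable setT (EFin \o u).
  exact: (integrable_residual (UVk i) mf s_ge mB).
have iv : Pr.-integrable setT (EFin \o v).
  exact: (integrable_residual (UVk j) mf s_ge mB).
have v0 : (\int[Pr]_w (v w)%:E = 0)%E := integral_residual_eq0 (UVk j) mf s_ge mB.
have [||| |//|? ->] := @integral_indepM _ _ _ Pr (fun w => \1_(others S j) w * u w) v.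
- exact: measurable_funM.
- exact: mv.
- move=> C D mC mD; apply: indep_indic_preimage => //.
    by rewrite -[X in measurable X]setTI; exact: mv.
  move=> C' mC'.
  pose A i' : set TV :=
    if i' == i then (fun z => (z.2 - f z.1) * \1_B z.1) @^-1` C' else setT.
  have mA i' : measurable (A i').
    by rewrite /A; case: ifP => // _; rewrite -[X in measurable X]setTI; exact: mr.
  have AE : \bigcap_(i' in [set i' | i' != j]) (Z i' @^-1` A i') = u @^-1` C'.
    apply/seteqP; split => w /=; first by move=> /(_ i ij); rewrite /A/= eqxx.
    by move=> h i' _; rewrite /A /=; case: eqVneq => [->|].
  have := @others_indep S j A _ mA (mr measurableT mD).
  by rewrite setTI AE.
- apply: (le_integrable measurableT _ _ iu).
    by apply/measurable_EFinP; exact: measurable_funM.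
  move=> w _; rewrite /= lee_fin normrM ler_piMl// indicE.
  by case: (_ \in _); rewrite ?normr1 ?normr0.
by split => //; rewrite v0 mule0.
Qed.

(** As for the cross terms, the squared residual of [j] is independent of [others S j]. Its mean is
    at most [s] times the probability that [U j] is in [B], and independence recombines this with
    [others S j] into [hits = S]. *)
Lemma integral_hits_diag (S : {set N}) j : j \in S ->
  Pr.-integrable setT (fun w => (\1_(hits @^-1` [set S]) w * (xi j w * xi j w))%:E) /\
  (\int[Pr]_w (\1_(hits @^-1` [set S]) w * (xi j w * xi j w))%:E <=
   s%:E * Pr (hits @^-1` [set S]))%E.
Proof.
move=> jS.
pose v w := xi j w ^+ 2 * \1_B (U j w).
(* The factor [cst 1] gives the first factor the shape treated by [indep_indic_preimage]. *)
have -> : (fun w => (\1_(hits @^-1` [set S]) w * (xi j w * xi j w))%:E) =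
    fun w => (\1_(others S j) w * cst 1 w * v w)%:E.
  apply/funext => w; congr EFin; rewrite (hits_others jS) /v !indicE in_setI.
  rewrite -[w \in _ @^-1` _]/(U j w \in B) /= mulr1 expr2.
  by case: (w \in _); case: (_ \in _); rewrite !(mul1r, mulr1, mul0r, mulr0).
have mv : measurable_fun setT v.
  exact: (@measurableT_comp _ _ _ Omega TV R _ setT _ mr2 (mZ j)).
have iv : Pr.-integrable setT (EFin \o v).
  exact: (integrable_sqr_residual (UVk j) mf s_ge mB).
have i1 : Pr.-integrable setT (EFin \o (fun w => \1_(others S j) w * cst 1 w)).
  have -> : (fun w => \1_(others S j) w * cst 1 w) = \1_(others S j) :> (_ -> R).
    by apply/funext => w; rewrite mulr1.
  exact: integrable_indic.
have [||| |//|? ->] := @integral_indepM _ _ _ Pr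
  (fun w => \1_(others S j) w * cst 1 w) v.
- exact: measurable_funM.
- exact: mv.
- move=> C D mC mD; apply: indep_indic_preimage => //.
    by rewrite -[X in measurable X]setTI; exact: mv.
  move=> C' mC'; have := @others_indep S j (fun=> setT) _ (fun=> measurableT)
    (mr2 measurableT mD).
  rewrite setTI (_ : \bigcap_(_ in _) _ = setT); last by apply/seteqP; split.
  rewrite setIT => H; rewrite preimage_cst; case: ifP => _; first by rewrite setIT.
  by rewrite setI0 set0I measure0 mul0e.
- exact: i1.
split => //.
have -> : (\int[Pr]_w (\1_(others S j) w * cst 1 w)%:E = Pr (others S j))%E.
  by under eq_integral do rewrite mulr1; rewrite integral_indic// setIT.
rewrite (hits_others jS).
have := @others_indep S j (fun=> setT) (B `*` setT) (fun=> measurableT).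
rewrite (_ : \bigcap_(_ in _) _ = setT); last by apply/seteqP; split.
rewrite setIT (_ : Z j @^-1` _ = U j @^-1` B); last first.
  by apply/seteqP; split => w /=; [case|].
move=> ->; last exact: measurableX.
rewrite muleCA; apply: lee_wpmul2l; first exact: measure_ge0.
exact: (integral_sqr_residual_le (UVk j) mf s_ge mB).
Qed.

Let mxiS (S : {set N}) : measurable_fun setT (fun w => \sum_(i in S) xi i w).
Proof.
by under eq_fun do rewrite big_mkcond/=; apply: measurable_sum => i; case: (i \in S).
Qed.

(** Expanding the square over pairs, the cross terms vanish and [#|S|] diagonal terms remain. *)
Lemma integral_hits_sqr_sum_le (S : {set N}) :
  (\int[Pr]_w (\1_(hits @^-1` [set S]) w * (\sum_(i in S) xi i w) ^+ 2)%:E <=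
   (#|S|%:R * s)%:E * Pr (hits @^-1` [set S]))%E.
Proof.
pose F (ij : N * N) : Omega -> \bar R := if (ij.1 \in S) && (ij.2 \in S) then
  fun w => (\1_(hits @^-1` [set S]) w * (xi ij.1 w * xi ij.2 w))%:E else cst 0%E.
have intF ij : Pr.-integrable setT (F ij).
  rewrite /F; case: ifP => [/andP[iS jS]|_]; last exact: integrable0.
  have [ij12|ij12] := eqVneq ij.1 ij.2.
    by rewrite ij12; case: (integral_hits_diag jS).
  by case: (integral_hits_cross iS jS ij12).
have FE w : (\1_(hits @^-1` [set S]) w * (\sum_(i in S) xi i w) ^+ 2)%:E =
    (\sum_ij F ij w)%E.
  rewrite expr2 mulr_suml mulr_sumr.
  under eq_bigr do rewrite !mulr_sumr.
  rewrite pair_big/= -sumEFin big_mkcond/=.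
  by apply: eq_bigr => -[i j] _; rewrite /F/=; case: ifP.
under eq_integral do rewrite FE.
rewrite integral_sum//.
have -> : ((#|S|%:R * s)%:E * Pr (hits @^-1` [set S]) =
    \sum_ij if (ij.1 \in S) && (ij.1 == ij.2)
      then s%:E * Pr (hits @^-1` [set S]) else 0)%E.
  rewrite -(@pair_big_dep _ _ _ _ _ xpredT (fun _ _ => true) (fun i j =>
    if (i \in S) && (i == j) then s%:E * Pr (hits @^-1` [set S]) else 0)%E)/=.
  transitivity (\sum_(i in S) s%:E * Pr (hits @^-1` [set S]))%E.
    have finP : Pr (hits @^-1` [set S]) \is a fin_num.
      by apply: fin_num_measure; exact: measurable_hits.
    by rewrite -(fineK finP) -!EFinM sumEFin sumr_const -mulrA mulr_natl.
  rewrite big_mkcond/=; apply: eq_bigr => i _; case: ifP => iS/=; last by rewrite big1.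
  rewrite (bigD1 i)//= eqxx big1 ?adde0// => j ji.
  by rewrite eq_sym (negbTE ji).
apply: lee_sum => -[i j] _; rewrite /F/=; have [->|ij] := eqVneq i j.
  rewrite andbb andbT; case: ifP => jS; last by rewrite integral0.
  by case: (integral_hits_diag jS).
rewrite andbF; case: ifP => [/andP[iS jS]|_]; last by rewrite integral0.
by case: (integral_hits_cross iS jS ij) => _ ->.
Qed.

(** Total expectation over the finitely many values of [hits]: the random index set is replaced by
    fixed ones. *)
Lemma integral_hits_split (q : {set N} -> Omega -> R) :
  (forall S, measurable_fun setT (q S)) -> (forall S w, 0 <= q S w) ->
  (\int[Pr]_w (q (hits w) w)%:E =
   \sum_S \int[Pr]_w (\1_(hits @^-1` [set S]) w * q S w)%:E)%E.
Proof.
move=> mq q0; rewrite -ge0_integral_sum//=.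
- apply: eq_integral => w _; rewrite sumEFin; congr EFin.
  rewrite (bigD1 (hits w))//= indicE mem_set// mul1r big1 ?addr0// => S Sw.
  by rewrite indicE memNset ?mul0r// => /= wS; case/eqP: Sw.
- move=> S; apply/measurable_EFinP; apply: measurable_funM => //.
  exact/measurable_indicP/measurable_hits.
- by move=> S w _; rewrite lee_fin mulr_ge0.
Qed.

Lemma sum_probability_hits (P : pred {set N}) :
  (\sum_(S | P S) Pr (hits @^-1` [set S]) = Pr [set w | P (hits w)])%E.
Proof.
have mP : measurable [set w | P (hits w)].
  have -> : [set w | P (hits w)] =
      \bigcup_(S in [set` P]) (hits @^-1` [set S]).
    by apply/seteqP; split => w /=; [exists (hits w)|move=> [S PS] /= ->].
  apply: fin_bigcup_measurable => [|S _]; last exact: measurable_hits.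
  exact: finite_finpred.
have := @integral_hits_split (fun S _ => (P S)%:R).
move=> /(_ (fun=> measurable_cst _) (fun _ _ => ler0n _ _)) E.
transitivity (\int[Pr]_w (P (hits w))%:R%:E)%E.
  rewrite E big_mkcond/=; apply: eq_bigr => S _; case: ifP => _.
    under eq_integral do rewrite mulr1.
    by rewrite integral_indic// ?setIT//; exact: measurable_hits.
  by under eq_integral do rewrite mulr0; rewrite integral0.
rewrite -[X in _ = Pr X]setIT -integral_indic//.
apply: eq_integral => w _; rewrite indicE; congr (_%:R%:E).
by case: (boolP (P (hits w))) => h; [rewrite mem_set|rewrite memNset//; apply/negP].
Qed.

Let p i : R := fine (Pr (U i @^-1` B)).

(** The moment bound is applied to the law of [hits]; pairwise independence is the product formula
    for the index set {i, j}. *)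
Lemma expected_reciprocal_hits_le :
  \sum_S fine (Pr (hits @^-1` [set S])) / #|S|.+1%:R <= 2 / (1 + \sum_i p i).
Proof.
have mUB i : measurable (U i @^-1` B) by exact: measurable_funPTI.
have sumE P : \sum_(S | P S) fine (Pr (hits @^-1` [set S])) =
    fine (Pr [set w | P (hits w)]).
  rewrite -sum_probability_hits sum_fine// => S _; apply: fin_num_measure.
  exact: measurable_hits.
apply: reciprocal_moment_le => [S||i|i j ij].
- by rewrite fine_ge0.
- by rewrite sumE (_ : [set w | _] = setT) ?probability_setT//; apply/seteqP.
- rewrite sumE; congr (fine (Pr _)); apply/seteqP; split => w /=; rewrite finset.inE.
    exact: set_mem.
  exact: mem_set.
- rewrite sumE /p -fineM ?fin_num_measure//; congr fine.
  pose A i' : set TV := if (i' == i) || (i' == j) then B `*` setT else setT.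
  have mA i' : measurable (A i') by rewrite /A; case: ifP => // _; exact: measurableX.
  have := indUV (finset.setU (finset.set1 i) (finset.set1 j)) mA.
  rewrite finset.big_setU1 ?finset.inE//= finset.big_set1 /A !eqxx/= orbT/=.
  have ZU i' : Z i' @^-1` (B `*` setT) = U i' @^-1` B.
    by apply/seteqP; split => w /=; [case|].
  rewrite -!ZU => <-; congr (Pr _); apply/seteqP; split => w /=.
    rewrite !finset.inE => /andP[/set_mem iB /set_mem jB] i'.
    by rewrite /= !finset.inE => /orP[]/eqP ->; rewrite /= eqxx ?orbT.
  move=> h; rewrite !finset.inE; apply/andP; split; apply: mem_set.
    by have := h i; rewrite /= !finset.inE eqxx /= => /(_ isT)[].
  by have := h j; rewrite /= !finset.inE eqxx orbT /= => /(_ isT)[].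
Qed.

(** Here [b] plays the squared bias and [c] the price of finding no point in [B]. Both [c] and the
    averaged noise are charged to the expectation of 1/(#|S|+1). *)
Lemma integral_sqr_hits_le (g : Omega -> R) (b c : R) : 0 <= b -> 0 <= c ->
  (forall w, hits w = finset.set0 -> g w ^+ 2 <= c) ->
  (forall w, hits w != finset.set0 -> g w ^+ 2 <=
    2 * b + 2 * ((\sum_(i in hits w) xi i w) / #|hits w|%:R) ^+ 2) ->
  (\int[Pr]_w (g w ^+ 2)%:E <= (2 * b + (4 * s + c) * (2 / (1 + \sum_i p i)))%:E)%E.
Proof.
move=> b0 c0 gc gb.
have s0 : 0 <= s.
  rewrite -lee_fin (le_trans _ (s_ge point))//.
  by apply: integral_ge0 => y _; rewrite lee_fin sqr_ge0.
(* One bound [q] covers both cases. For empty [S] the quotient in [a S] is [c] itself and [e S] is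
   0, as division by 0 gives 0. For nonempty [S] the extra quotient only weakens the bound. *)
pose a (S : {set N}) : R := 2 * b + c / #|S|.+1%:R.
pose e (S : {set N}) : R := 2 / #|S|%:R ^+ 2.
have a0 S : 0 <= a S by rewrite addr_ge0 ?mulr_ge0.
have e0 S : 0 <= e S by rewrite divr_ge0 ?sqr_ge0.
pose q S w : R := a S + e S * (\sum_(i in S) xi i w) ^+ 2.
have mq S : measurable_fun setT (q S).
  by apply: measurable_funD => //; apply: measurable_funM => //; exact: measurable_funX.
have q0 S w : 0 <= q S w.
  by apply: addr_ge0 => //; apply: mulr_ge0 => //; exact: sqr_ge0.
have gq w : g w ^+ 2 <= q (hits w) w.
  rewrite /q /a /e; have [h0|h0] := eqVneq (hits w) finset.set0.
    rewrite h0 finset.cards0 expr0n invr0 mulr0 mul0r addr0 divr1.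
    by rewrite (le_trans (gc w h0))// lerDr mulr_ge0.
  rewrite (le_trans (gb w h0))// -addrA lerD2l expr_div_n mulrCA mulrC -mulrA.
  by rewrite [_^-1 * _]mulrC lerDr divr_ge0.
apply: (@le_trans _ _ (\int[Pr]_w (q (hits w) w)%:E)%E).
  by apply: ge0_le_integralT => w; rewrite lee_fin ?sqr_ge0.
rewrite integral_hits_split//.
pose P S := fine (Pr (hits @^-1` [set S])).
have PE S : Pr (hits @^-1` [set S]) = (P S)%:E.
  by rewrite fineK//; apply: fin_num_measure; exact: measurable_hits.
have P0 S : 0 <= P S by rewrite fine_ge0.
have m1 S : measurable_fun setT (\1_(hits @^-1` [set S]) : Omega -> R).
  exact/measurable_indicP/measurable_hits.
have main S : (\int[Pr]_w (\1_(hits @^-1` [set S]) w * q S w)%:E <=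
    (2 * b * P S + (4 * s + c) * (P S / #|S|.+1%:R))%:E)%E.
  have -> : (\int[Pr]_w (\1_(hits @^-1` [set S]) w * q S w)%:E =
    (a S * P S)%:E + (e S)%:E *
      \int[Pr]_w (\1_(hits @^-1` [set S]) w * (\sum_(i in S) xi i w) ^+ 2)%:E)%E.
    rewrite EFinM -PE -[X in (_ * Pr X)%E]setIT -integral_indic//; last first.
      exact: measurable_hits.
    rewrite -!ge0_integralZl_EFin//.
    - rewrite -ge0_integralD//.
      + apply: eq_integral => w _; rewrite -!EFinM -EFinD; congr EFin.
        by rewrite /q; ring.
      + by move=> w _; apply: mule_ge0; rewrite lee_fin.
      + by apply: measurable_funeM; exact/measurable_EFinP.
      + move=> w _; apply: mule_ge0; rewrite lee_fin//.
        by apply: mulr_ge0 => //; exact: sqr_ge0.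
      + apply: measurable_funeM.
        exact/measurable_EFinP/measurable_funM/measurable_funX.
    - by move=> w _; rewrite lee_fin mulr_ge0 ?sqr_ge0.
    - apply/measurable_EFinP; apply: measurable_funM => //.
      exact: measurable_funX.
    - exact/measurable_EFinP.
  have := integral_hits_sqr_sum_le S; rewrite PE => le.
  have es0 : (0 <= (e S)%:E)%E by rewrite lee_fin.
  apply: (le_trans (leeD (lexx _) (lee_wpmul2l es0 le))).
  rewrite -!EFinM -EFinD lee_fin /a mulrDl -addrA lerD2l [leRHS]mulrDl addrC lerD//.
    rewrite mulrA [leRHS]mulrCA [leRHS]mulrC ler_wpM2r// /e.
    have [->|S0] := posnP #|S|; first by rewrite mul0r mulr0 divr1 mulr_ge0.
    have S1 : 1 <= #|S|%:R :> R by rewrite ler1n.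
    (* The factor 4 comes from 2/m <= 4/(m+1), valid for m >= 1. *)
    rewrite -[#|S|.+1%:R]natr1; move: (#|S|%:R : R) S1 => m m1'.
    have -> : 2 / m ^+ 2 * (m * s) = s * (2 / m) by field; apply/eqP; lra.
    rewrite -[4 * s]mulrC -mulrA ler_wpM2l//.
    rewrite ler_pdivrMr; last lra.
    rewrite mulrAC ler_pdivlMr; lra.
  by rewrite mulrAC mulrA.
apply: (@le_trans _ _ (\sum_S (2 * b * P S + (4 * s + c) * (P S / #|S|.+1%:R))%:E)%E).
  by apply: lee_sum => S _; exact: main.
rewrite sumEFin lee_fin big_split/= -!mulr_sumr.
have -> : \sum_S P S = 1.
  rewrite /P sum_fine; last by move=> S _; rewrite PE.
  rewrite (sum_probability_hits xpredT) (_ : [set w | _] = setT).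
    by rewrite probability_setT.
  exact/seteqP.
rewrite mulr1 lerD2l ler_wpM2l ?addr_ge0 ?mulr_ge0//.
exact: expected_reciprocal_hits_le.
Qed.

End sample.

(** * Measurability in metric spaces *)

Lemma measurable_invr (R : realType) : measurable_fun [set: R] (@GRing.inv R).
Proof.
have -> : @GRing.inv R = fun r => if r == 0 then 0 else r^-1.
  by apply/funext => r; case: eqVneq => [->|//]; rewrite invr0.
apply: measurable_fun_if => //=.
  exact: measurable_fun_eqr.
have -> : setT `&` (fun r : R => r == 0) @^-1` [set false] = [set r | r != 0].
  by apply/seteqP; split => r /=; [case=> _ ->|move=> /negbTE].
apply: open_continuous_measurable_fun => [|r].
  exact: open_neq.
by rewrite inE /= => r0; exact: inv_continuous.
Qed.

Lemma measurable_inve d (T : measurableType d) (R : realType) (m : T -> \bar R) :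
  measurable_fun setT m -> (forall x, m x \is a fin_num) ->
  measurable_fun setT (fun x => (m x)^-1)%E.
Proof.
move=> mm finm.
have -> : (fun x => (m x)^-1)%E =
    fun x => if (m x == 0)%E then +oo%E else ((fine (m x))^-1)%:E.
  by apply/funext => x; have := finm x; case: (m x).
apply: measurable_fun_ifT => //; first exact: measurable_fun_eqe.
apply/measurable_EFinP; apply: measurableT_comp (@measurable_invr R) _.
exact: measurableT_comp.
Qed.

Section metric.
Context (R : realType) (M : pmetricType R).

Lemma open_measurable_borel (U : set M) : open U -> measurable (U : set (borel M)).
Proof. by move=> oU; apply: sub_sigma_algebra. Qed.

Lemma open_mdist_lt (x : M) (r : R) : open [set y | mdist x y < r].
Proof.
rewrite openE => y /= xy; apply/nbhs_ballP.
exists (r - mdist x y); first by rewrite /= subr_gt0.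
rewrite ballEmdist => z /= yz; apply: le_lt_trans (metric_triangle x y z) _; lra.
Qed.

Lemma measurable_cball (x : M) (r : R) : measurable (cball x r : set (borel M)).
Proof.
rewrite -[X in measurable X]setCK; apply: measurableC; apply: open_measurable_borel.
rewrite openE => y /= /negP; rewrite -ltNge => xy.
apply/nbhs_ballP; exists (mdist x y - r); first by rewrite /= subr_gt0.
rewrite ballEmdist => z /= yz; apply/negP; rewrite -ltNge.
have := metric_triangle x z y; rewrite (metric_sym z y) => ?; lra.
Qed.

Lemma hoelder_measurable (f : M -> R) (L beta : R) : 0 < L -> 0 < beta ->
  (forall z z', `|f z - f z'| <= L * (mdist z z') `^ beta) ->
  measurable_fun [set: borel M] f.
Proof.
move=> L0 b0 fL; apply: (measurability _ (RGenOInfty.measurableE R)) => //.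
move=> _ [_ [x ->] <-]; rewrite setTI; apply: open_measurable_borel.
rewrite openE => z /=; rewrite in_itv/= andbT => xz.
have e0 : 0 < (f z - x) / (2 * L) by rewrite divr_gt0 ?mulr_gt0 ?subr_gt0.
(* Within this radius the Hoelder bound is at most half of the gap [f z - x], so [f] stays above
   [x]. *)
apply/nbhs_ballP; exists (((f z - x) / (2 * L)) `^ beta^-1); first exact: powR_gt0.
rewrite ballEmdist => y /= zy; rewrite in_itv/= andbT.
have : (mdist z y) `^ beta <= (f z - x) / (2 * L).
  have -> : (f z - x) / (2 * L) = (((f z - x) / (2 * L)) `^ beta^-1) `^ beta.
    by rewrite -powRrM mulVf ?gt_eqF// powRr1// ltW.
  by apply: ge0_ler_powR; rewrite ?nnegrE ?powR_ge0 ?mdist_ge0// ltW.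
rewrite -(ler_pM2l L0) => h.
have := le_trans (fL z y) h.
have -> : L * ((f z - x) / (2 * L)) = (f z - x) / 2 by field; rewrite gt_eqF.
by rewrite ler_norml => /andP[_ ?]; lra.
Qed.
End metric.

Section separable.
Context (R : realType) (M : pmetricType R) (D : set M) (h : R).

(* For [x] in [closure D] the condition amounts to [mdist y x <= h]; written as
   a countable combination of rectangles, it is measurable for the product
   sigma-algebra even if [M] is not separable. *)
Definition close_pairs : set (borel M * borel M) :=
  \bigcap_k \bigcup_(q in D) ([set y | mdist q y < h + k.+1%:R^-1] `*`
                              [set x | mdist q x < k.+1%:R^-1]).

Lemma measurable_close_pairs : countable D -> measurable close_pairs.
Proof.
move=> cD; apply: bigcapT_measurable => k; rewrite bigcup_set_type.
apply: countable_bigcupT_measurable => [|q].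
  by rewrite (eq_countable (card_setT _)).
by apply: measurableX; apply: open_measurable_borel; exact: open_mdist_lt.
Qed.

(** If [y] is within [h] of [x], any [q] in [D] close enough to [x] is a witness, and the closure
    provides one for each k. Conversely, the triangle inequality through [q] gives the bound h +
    2/(k+1) for every k. *)
Lemma close_pairsP (x y : M) : closure D x -> close_pairs (y, x) <-> mdist x y <= h.
Proof.
move=> Dx; split => [yx|xy].
  apply/ler_addgt0Pr => e e0.
  have [k ke] : exists k : nat, k.+1%:R^-1 < e / 2.
    have [k] := ltr_add_invr (divr_gt0 e0 (ltr0n R 2)).
    by rewrite add0r; exists k.
  have [q Dq [qy qx]] := yx k Logic.I.
  have {}qy : mdist q y < h + k.+1%:R^-1 := qy.
  have {}qx : mdist q x < k.+1%:R^-1 := qx.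
  have : mdist x y <= mdist q x + mdist q y.
    by rewrite (metric_sym q x); exact: metric_triangle.
  have qx2 : mdist q x <= e / 2 by exact: ltW (lt_trans qx ke).
  have qy2 : mdist q y <= h + e / 2.
    by apply: ltW (lt_trans qy _); rewrite ltrD2l.
  by move=> /le_trans; apply; rewrite (le_trans (lerD qx2 qy2))// addrCA -splitr.
move=> k _; have k0 : 0 < k.+1%:R^-1 :> R by rewrite invr_gt0.
have [q [Dq]] := Dx _ (nbhsx_ballx x _ k0).
rewrite ballEmdist/= => xq; exists q => //; split => /=; last by rewrite metric_sym.
apply: le_lt_trans (_ : mdist x q + mdist x y < _).
  by rewrite (metric_sym x q); exact: metric_triangle.
by rewrite addrC; apply: ler_ltD.
Qed.

Lemma measurable_closure : measurable (closure D : set (borel M)).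
Proof.
rewrite -[X in measurable X]setCK; apply: measurableC; apply: open_measurable_borel.
by apply: closed_openC; exact: closed_closure.
Qed.
End separable.

(* Where the estimator is set to 0 both sums vanish, and [0 / 0 = 0]. *)
Lemma nadaraya_watsonE (R : realType) (M : metricType R) n h
    (x_ : 'I_n -> M) (y_ : 'I_n -> R) x :
  nadaraya_watson h x_ y_ x =
  (\sum_(i < n) y_ i * \1_(cball x h) (x_ i)) / (\sum_(i < n) \1_(cball x h) (x_ i)).
Proof.
rewrite /nadaraya_watson; case: ifPn => // /negP xG.
rewrite [X in _ / X]big1 ?invr0 ?mulr0// => i _.
rewrite indicE memNset// => xi; apply: xG; apply/mem_set; exists i => //.
by rewrite /cball/= metric_sym.
Qed.

(** * The Nadaraya-Watson estimator *)

(** Take for [B] the ball around [x]. With no point in it the estimator is 0 and the squared error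
    is [f x ^+ 2]; otherwise the error is the averaged residual plus an average [D] of differences
    [f (X i w) - f x], each bounded by the Hoelder condition. *)
Lemma nadaraya_watson_risk_at (R : realType) (M : pmetricType R) d
    (Omega : measurableType d) (Pr : probability Omega R) n
    (X : 'I_n -> {RV Pr >-> borel M}) (Y : 'I_n -> {RV Pr >-> measurableTypeR R})
    (k : R.-pker (borel M) ~> (measurableTypeR R)) (L beta s h : R) :
  let f : M -> R := regression k in
  0 < L -> 0 < beta -> 0 < h ->
  mutually_independent Pr (fun i w => (X i w, Y i w)) ->
  (forall i, cond_distribution (X i) (Y i) k) ->
  (forall z z', `|f z - f z'| <= L * (mdist z z') `^ beta) ->
  (forall z, (\int[k z]_y (((y : R) - f z) ^+ 2)%:E <= s%:E)%E) ->
  forall x : M,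
  (\int[Pr]_w ((nadaraya_watson h (X ^~ w) (Y ^~ w) x - f x) ^+ 2)%:E <=
   (2 * (L * h `^ beta) ^+ 2 + (4 * s + f x ^+ 2) *
     (2 / (1 + \sum_(i < n) fine (Pr (X i @^-1` cball x h)))))%:E)%E.
Proof.
move=> f L0 b0 h0 ind cond fL s_ge x.
have mf : measurable_fun [set: borel M] f by exact: hoelder_measurable fL.
pose B : set (borel M) := cball x h.
apply: (integral_sqr_hits_le ind cond mf s_ge (measurable_cball x h)).
- exact: sqr_ge0.
- exact: sqr_ge0.
- move=> w w0; rewrite nadaraya_watsonE big1 ?mul0r ?sub0r ?sqrrN// => i _.
  have : i \notin hits X B w by rewrite w0 finset.inE.
  by rewrite finset.inE indicE => /negbTE ->; rewrite mulr0.
- move=> w w0; set S := hits X B w.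
  have inS i : \1_(cball x h) (X i w) = (i \in S)%:R :> R by rewrite finset.inE indicE.
  rewrite nadaraya_watsonE.
  under eq_bigr do rewrite inS.
  under [X in _ / X]eq_bigr do rewrite inS.
  have -> : \sum_(i < n) (i \in S)%:R = #|S|%:R :> R.
    rewrite -sum1_card natr_sum [RHS]big_mkcond/=.
    by apply: eq_bigr => i _; case: (i \in S).
  have -> : \sum_(i < n) Y i w * (i \in S)%:R = \sum_(i in S) (Y i w : R).
    rewrite [RHS]big_mkcond/=.
    by apply: eq_bigr => i _; case: (i \in S); rewrite ?mulr1 ?mulr0.
  have m0 : 0 < #|S|%:R :> R by rewrite ltr0n finset.card_gt0.
  set m : R := #|S|%:R in m0 *.
  pose D := (\sum_(i in S) (f (X i w) - f x)) / m.
  have -> : (\sum_(i in S) (Y i w : R)) / m - f x =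
      (\sum_(i in S) (Y i w - f (X i w))) / m + D.
    rewrite /D -mulrDl -big_split/=.
    have -> : \sum_(i in S) (Y i w - f (X i w) + (f (X i w) - f x)) =
        \sum_(i in S) (Y i w : R) - m * f x.
      have -> : m * f x = \sum_(i in S) f x by rewrite sumr_const mulr_natl.
      rewrite -sumrB; apply: eq_bigr => i _; ring.
    by field; rewrite gt_eqF.
  have Dle : `|D| <= L * h `^ beta.
    rewrite /D normrM [`|m^-1|]gtr0_norm ?invr_gt0// ler_pdivrMr//.
    apply: le_trans (ler_norm_sum _ _ _) _.
    apply: (@le_trans _ _ (\sum_(i in S) L * h `^ beta)); last first.
      by rewrite sumr_const -[leLHS]mulr_natr.
    apply: ler_sum => i; rewrite finset.inE => /set_mem iB.
    apply: le_trans (fL _ _) _; rewrite ler_pM2l//.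
    apply: ge0_ler_powR; rewrite ?nnegrE ?mdist_ge0 ?(ltW h0) ?(ltW b0)//.
    by rewrite metric_sym.
  have D2 : D ^+ 2 <= (L * h `^ beta) ^+ 2.
    rewrite -(real_normK (num_real D)) lerXn2r ?nnegrE//.
    by rewrite mulr_ge0 ?powR_ge0// ltW.
  (* (a + D)^2 = 2 a^2 + 2 D^2 - (a - D)^2. *)
  set a := _ / m; have := sqr_ge0 (a - D); nra.
Qed.

(** * The mixture and the numerical constant *)

Section mixture_facts.
Context (R : realType) (M : pmetricType R) (P Q : probability (borel M) R).
Context (nP nQ : nat).
Let n := (nP + nQ)%N.

Lemma mixtureE (A : set (borel M)) : measurable A ->
  mixture nP nQ P Q A =
  (nP%:R / n%:R * fine (P A) + nQ%:R / n%:R * fine (Q A))%:E.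
Proof.
move=> mA.
have EM (r : R) (p : probability (borel M) R) : (r * fine (p A))%:E = (r%:E * p A)%E.
  by rewrite EFinM fineK ?fin_num_measure.
by rewrite EFinD !EM; exact: measure_addE.
Qed.

Lemma mixture_le1 (A : set (borel M)) : (0 < n)%N -> measurable A ->
  (mixture nP nQ P Q A <= 1)%E.
Proof.
move=> n0 mA; rewrite mixtureE// lee_fin.
have P1 : fine (P A) <= 1 by rewrite -lee_fin fineK ?fin_num_measure// probability_le1.
have Q1 : fine (Q A) <= 1 by rewrite -lee_fin fineK ?fin_num_measure// probability_le1.
have nR : 0 < n%:R :> R by rewrite ltr0n.
apply: (@le_trans _ _ (nP%:R / n%:R + nQ%:R / n%:R)).
  by apply: lerD; apply: ler_piMr => //; rewrite divr_ge0.
by rewrite -mulrDl -natrD divff ?gt_eqF.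
Qed.

(** The expected number of sample points in [A] involves the two sample laws only through their
    mixture; this is how [mixture] enters the bound. *)
Lemma sum_hit_probabilities d (Omega : measurableType d) (Pr : probability Omega R)
    (X : 'I_(nP + nQ) -> {RV Pr >-> borel M}) (A : set (borel M)) :
  (0 < n)%N -> measurable A ->
  (forall i, distribution Pr (X i) A = if (i < nP)%N then P A else Q A) ->
  \sum_(i < nP + nQ) fine (Pr (X i @^-1` A)) = n%:R * fine (mixture nP nQ P Q A).
Proof.
move=> n0 mA XA; rewrite mixtureE//=.
have XE i : Pr (X i @^-1` A) = if (i < nP)%N then P A else Q A by exact: XA.
rewrite big_split_ord/=.
under eq_bigr do rewrite XE /= ltn_ord.
under [X in _ + X]eq_bigr do rewrite XE /= ltnNge leq_addr/=.
rewrite !sumr_const !card_ord -[_ *+ nP]mulr_natl -[_ *+ nQ]mulr_natl.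
by field; rewrite pnatr_eq0 -lt0n.
Qed.
End mixture_facts.

(** The constant 8 is 4 * 2, from [4 * s + c <= 4 * C] and 2/(1 + n m) <= 2/(n m); the bias only
    asks for 2. *)
Lemma risk_bound_le (R : realType) (n : nat) (b s c C m : R) :
  (0 < n)%N -> 0 <= b -> 0 <= s -> 0 <= c -> s + c <= C -> 0 <= m ->
  ((2 * b + (4 * s + c) * (2 / (1 + n%:R * m)))%:E <=
   8%:E * (b%:E + (C / n%:R)%:E * (m%:E)^-1))%E.
Proof.
move=> n0 b0 s0 c0 scC; have nR : 0 < n%:R :> R by rewrite ltr0n.
rewrite le_eqVlt => /predU1P[<-|m0].
  (* For a null ball the inverse is [+oo], and so is the right side unless [C = 0]. In that case [s]
     and [c] vanish too, and the bias alone remains. *)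
  rewrite mulr0 addr0 divr1 inve0.
  have [C0|C0] := ltP 0 C.
    by rewrite gt0_muley ?lte_fin ?divr_gt0// addey// gt0_muley ?lte_fin// leey.
  have -> : C = 0 by lra.
  by rewrite mul0r mul0e adde0 -EFinM lee_fin; lra.
rewrite inver gt_eqF// -!(EFinM, EFinD) lee_fin mulrDr.
apply: lerD; first lra.
apply: (@le_trans _ _ ((4 * C) * (2 / (n%:R * m)))).
  apply: ler_pM; [lra|by rewrite divr_ge0// addr_ge0// mulr_ge0// ltW|lra|].
  by rewrite ler_pM2l// lef_pV2 ?posrE ?mulr_gt0 ?addr_gt0 ?mulr_gt0// lerDr.
rewrite le_eqVlt; apply/orP; left; apply/eqP; field.
by rewrite !gt_eqF.
Qed.

(** * Exchange of the integrals over the sample and over [Q] *)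

Section joint.
Context (R : realType) (M : pmetricType R) d (Omega : measurableType d).
Context (Pr : probability Omega R) (Q : probability (borel M) R) (n : nat).
Variables (X : 'I_n -> {RV Pr >-> borel M}) (Y : 'I_n -> {RV Pr >-> measurableTypeR R}).
Variables (D : set M) (h : R) (f : M -> R).
Hypotheses (cD : countable D) (QD : Q (closure D) = 1%E).
Hypothesis mf : measurable_fun [set: borel M] f.

Let OM : measurableType _ := (Omega * borel M)%type.
Let hit (i : 'I_n) (z : OM) : R := \1_(close_pairs D h) (X i z.1, z.2).
(** A jointly measurable version of the squared error: the ball condition is replaced by
    [close_pairs], which agrees with it over [closure D], and the rest of the space is cut off. *)
Let err (z : OM) : R :=
  (((\sum_(i < n) Y i z.1 * hit i z) / (\sum_(i < n) hit i z) - f z.2) ^+ 2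
    * \1_(closure D) z.2).

Let mhit i : measurable_fun [set: OM] (hit i).
Proof.
have mpair : measurable_fun [set: OM] (fun z => (X i z.1, z.2) : borel M * borel M).
  apply: measurable_fun_pair; last exact: measurable_snd.
  by apply: measurableT_comp => //; exact: measurable_fst.
apply: (@measurableT_comp _ _ _ OM (borel M * borel M)%type R
  (\1_(close_pairs D h)) setT _ _ mpair).
by apply: measurable_indic; exact: measurable_close_pairs.
Qed.

Let mYi i : measurable_fun [set: OM] (fun z => Y i z.1 : R).
Proof.
apply: (@measurableT_comp _ _ _ OM Omega R (Y i : Omega -> R) setT fst).
  have mY : measurable_fun [set: Omega] (Y i) by exact: measurable_funP.
  exact: mY.
exact: measurable_fst.
Qed.

Let merr : measurable_fun [set: OM] err.
Proof.
apply: measurable_funM.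
  apply: measurable_funX; apply: measurable_funB.
    apply: measurable_funM.
      by apply: measurable_sum => i; exact: measurable_funM.
    apply: measurableT_comp (@measurable_invr R) _.
    exact: measurable_sum.
  by apply: measurableT_comp mf _; exact: measurable_snd.
apply: (@measurableT_comp _ _ _ OM (borel M) R (\1_(closure D)) setT snd).
  by apply: measurable_indic; exact: measurable_closure.
exact: measurable_snd.
Qed.

Let err_ge0 z : 0 <= err z.
Proof. by rewrite mulr_ge0 ?sqr_ge0. Qed.

Let errE w x : closure D x ->
  err (w, x) = (nadaraya_watson h (X ^~ w) (Y ^~ w) x - f x) ^+ 2.
Proof.
move=> Dx; rewrite /err/= indicE mem_set// mulr1 nadaraya_watsonE.
have hitE i : hit i (w, x) = \1_(cball x h) (X i w).
  rewrite /hit !indicE; congr (nat_of_bool _)%:R.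
  apply/idP/idP => /set_mem xy; apply/mem_set.
    exact/(close_pairsP h _ Dx).
  exact/(close_pairsP h _ Dx).
by under eq_bigr do rewrite hitE; under [X in _ / X]eq_bigr do rewrite hitE.
Qed.

Let mnw w : measurable_fun [set: borel M]
  (fun x => (nadaraya_watson h (X ^~ w) (Y ^~ w) x - f x) ^+ 2).
Proof.
have m1 i : measurable_fun [set: borel M] (fun x => \1_(cball x h) (X i w) : R).
  have -> : (fun x => \1_(cball x h) (X i w) : R) = \1_(cball (X i w) h).
    apply/funext => x; rewrite !indicE; congr (nat_of_bool _)%:R.
    by apply/idP/idP => /set_mem xy; apply/mem_set; rewrite /cball/= metric_sym.
  by apply: measurable_indic; exact: measurable_cball.
under eq_fun do rewrite nadaraya_watsonE.
apply: measurable_funX; apply: measurable_funB => //; apply: measurable_funM.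
  by apply: measurable_sum => i; exact: measurable_funM.
by apply: measurableT_comp (@measurable_invr R) _; exact: measurable_sum.
Qed.

(** As [closure D] carries [Q], for each sample the squared error and [err] have the same integral
    over [Q]. Tonelli applies to [err], whose integral over the sample is at most [F x] on
    [closure D] and 0 elsewhere. *)
Lemma expected_sqL2_le (F : M -> \bar R) :
  measurable_fun [set: borel M] F -> (forall x, 0 <= F x)%E ->
  (forall x, closure D x ->
    \int[Pr]_w ((nadaraya_watson h (X ^~ w) (Y ^~ w) x - f x) ^+ 2)%:E <= F x)%E ->
  (\int[Pr]_w sqL2norm Q (nadaraya_watson h (X ^~ w) (Y ^~ w) \- f)%R <=
   \int[Q]_x F x)%E.
Proof.
move=> mF F0 leF.
apply: (@le_trans _ _ (\int[Pr]_w \int[Q]_x (err (w, x))%:E)%E).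
  apply: ge0_le_integralT => w.
    by apply: integral_ge0 => x _; rewrite lee_fin sqr_ge0.
  rewrite le_eqVlt; apply/orP; left; apply/eqP; apply: ge0_ae_eq_integral => //.
  - by apply/measurable_EFinP; exact: mnw.
  - apply/measurable_EFinP.
    exact: (@measurableT_comp _ _ _ (borel M) OM R err setT _ merr
      (pair1_measurable w)).
  - by move=> x _; rewrite lee_fin sqr_ge0.
  - by move=> x _; rewrite lee_fin.
  - exists (~` closure D); split.
    + by apply: measurableC; exact: measurable_closure.
    + transitivity (1 - Q (closure D))%E; last by rewrite QD subee.
      by apply: probability_setC; exact: measurable_closure.
    + by move=> x /= + Dx; apply => _; rewrite errE.
rewrite (@fubini_tonelli _ _ _ _ R Pr Q (fun z => (err z)%:E)); first last.
- by move=> z; rewrite lee_fin.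
- exact/measurable_EFinP.
apply: ge0_le_integralT => x.
  by apply: integral_ge0 => w _; rewrite lee_fin.
have [Dx|Dx] := pselect (closure D x).
  by under eq_integral do rewrite errE//; exact: leF.
under eq_integral do rewrite /err/= indicE memNset// mulr0.
by rewrite integral0.
Qed.
End joint.

Theorem theorem1 (R : realType) :
  exists c_u : R, 0 < c_u /\
  forall (M : pmetricType R) (P Q : probability (borel M) R)
    (L beta sigma : R) (nP nQ : nat)
    (d : measure_display) (Omega : measurableType d)
    (Pr : probability Omega R)
    (X : 'I_(nP + nQ) -> {RV Pr >-> borel M})
    (Y : 'I_(nP + nQ) -> {RV Pr >-> measurableTypeR R})
    (k : R.-pker (borel M) ~> (measurableTypeR R)),
  let n := (nP + nQ)%N in
  let fstar : M -> R := regression k in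
  separably_supported Q ->
  0 < L -> 0 < beta -> beta <= 1 -> 0 <= sigma -> (1 <= n)%N ->
  mutually_independent Pr (fun i w => (X i w, Y i w)) ->
  (forall i, cond_distribution (X i) (Y i) k) ->
  (forall i (A : set (borel M)), measurable A ->
     distribution Pr (X i) A = if (i < nP)%N then P A else Q A) ->
  (forall z z' : M, `|fstar z - fstar z'| <= L * (mdist z z') `^ beta) ->
  (ereal_sup [set cond_expectation k (fun x y => (((y : R) - fstar x) ^+ 2)%R) x
             | x in [set: borel M]] <= (sigma ^+ 2)%:E)%E ->
  forall h : R, 0 < h ->
  (\int[Pr]_w
     sqL2norm Q (nadaraya_watson h (X ^~ w) (Y ^~ w) \- fstar)%R
   <= c_u%:E *
      ((L ^+ 2 * h `^ (2 * beta))%:E +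
       (supnorm fstar ^+ 2 + (sigma ^+ 2)%:E) / (n%:R)%:E *
       similarity (mixture nP nQ P Q) Q h))%E.

Proof.
exists 8; split=> // M P Q L beta sigma nP nQ d Omega Pr X Y k n fstar sepQ.
move=> L0 b0 b1 sg0 n1 ind cond law hold noise h h0.
have mf : measurable_fun [set: borel M] fstar by exact: hoelder_measurable hold.
have [D cD QD] := sepQ.
pose s := sigma ^+ 2; have s0 : 0 <= s by exact: sqr_ge0.
have s_ge z : (\int[k z]_y (((y : R) - fstar z) ^+ 2)%:E <= s%:E)%E.
  by apply: le_trans noise; apply: ereal_sup_ubound; exists z.
have nR : 0 < n%:R :> R by rewrite ltr0n.
pose mu (x : M) := mixture nP nQ P Q (cball x h).
have mB (x : M) := measurable_cball x h.
have mu0 x : (0 <= mu x)%E by exact: measure_ge0.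
have mu1 x : (mu x <= 1)%E by exact: mixture_le1.
have mufin x : mu x \is a fin_num by rewrite /mu mixtureE.
set b := (L ^+ 2 * h `^ (2 * beta)).
have bE : b = (L * h `^ beta) ^+ 2.
  by rewrite exprMn /b mulrC [2 * _]mulrC powRrM powR_mulrn ?powR_ge0// mulrC.
have bge0 : 0 <= b by rewrite bE sqr_ge0.
have sup_ge x : (`|fstar x|%:E <= supnorm fstar)%E.
  by apply: ereal_sup_ubound; exists x.
(* Balls have mass at most 1, so the similarity is at least 1. Its positivity matters when
   [supnorm fstar] is [+oo]: the product is then [+oo] and not [+oo * 0 = 0]. *)
have sim1 : (1 <= similarity (mixture nP nQ P Q) Q h)%E.
  rewrite -(probability_setT Q) -[leLHS]mul1e -integral_cst//.
  apply: ge0_le_integralT => x; first exact: lee01.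
  by rewrite /= inve_ge1; [exact: mu1|exact: mu0].
have sup0 : (0 <= supnorm fstar)%E by exact: le_trans (sup_ge point).
case EF : (supnorm fstar) sup0 => [F| |] // F0; last first.
- have -> : (+oo ^+ 2 + (sigma ^+ 2)%:E = +oo :> \bar R)%E by rewrite expe2 mulyy addye.
  rewrite inver gt_eqF// gt0_mulye ?lte_fin ?invr_gt0//.
  by rewrite gt0_mulye ?(lt_le_trans lte01)// addey// gt0_muley ?lte_fin// leey.
rewrite lee_fin in F0; pose C := F ^+ 2 + s.
(* [phi] is a measurable minorant of the integrand of [similarity]: over [closure D] the section of
   [E] is the ball, and elsewhere [phi] is 0. The bound can thus be integrated with [phi] and
   compared with [similarity] at the end. *)
pose E := close_pairs D h.
pose phi (x : borel M) : \bar R :=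
  ((mixture nP nQ P Q (ysection E x))^-1 * (\1_(closure D) x)%:E)%E.
have ysE x : closure D x -> ysection E x = cball x h.
  move=> Dx; rewrite ysectionE; apply/seteqP; split => y /= xy.
    exact/(close_pairsP h _ Dx).
  exact/(close_pairsP h _ Dx).
have mE : measurable E by exact: measurable_close_pairs.
have mys x : measurable (ysection E x) by exact: measurable_ysection.
have mphi : measurable_fun setT phi.
  apply: emeasurable_funM.
    apply: measurable_inve => [|x]; last by rewrite mixtureE.
    under eq_fun do rewrite mixtureE//.
    apply/measurable_EFinP; apply: measurable_funD; apply: measurable_funM => //;
      by apply: measurableT_comp => //; exact: measurable_fun_ysection.
  by apply/measurable_EFinP; apply: measurable_indic; exact: measurable_closure.
have phi0 x : (0 <= phi x)%E by rewrite mule_ge0 ?inve_ge0 ?measure_ge0 ?lee_fin.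
have C0 : 0 <= C by rewrite addr_ge0 ?sqr_ge0.
have phi_le : (\int[Q]_x phi x <= similarity (mixture nP nQ P Q) Q h)%E.
  apply: ge0_le_integralT => x //; rewrite /phi indicE.
  have [/set_mem Dx|_] := boolP (x \in closure D); first by rewrite mule1 ysE.
  by rewrite mule0 inve_ge0.
pose G (x : borel M) : \bar R := (8%:E * (b%:E + (C / n%:R)%:E * phi x))%E.
have G0 x : (0 <= G x)%E.
  by rewrite mule_ge0 ?lee_fin// adde_ge0 ?lee_fin// mule_ge0// lee_fin divr_ge0.
have mG : measurable_fun [set: borel M] G.
  by apply: measurable_funeM; apply: emeasurable_funD => //; exact: measurable_funeM.
apply: (@le_trans _ _ (\int[Q]_x G x)%E).
  apply: (expected_sqL2_le cD QD mf mG G0) => x Dx.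
  apply: (le_trans (nadaraya_watson_risk_at L0 b0 h0 ind cond hold s_ge x)).
  rewrite (sum_hit_probabilities n1 (mB x) (fun i => law i _ (mB x))) -bE.
  rewrite /G /phi indicE mem_set// mule1 ysE// -[X in (X^-1)%E](fineK (mufin x)).
  apply: risk_bound_le => //.
  - exact: sqr_ge0.
  - rewrite /C addrC lerD2r -(real_normK (num_real (fstar x))).
    by rewrite lerXn2r ?nnegrE// -lee_fin -EF.
rewrite /G ge0_integralZl//; last 2 first.
- by apply: emeasurable_funD => //; exact: measurable_funeM.
- by move=> x _; rewrite adde_ge0 ?lee_fin// mule_ge0// lee_fin divr_ge0.
rewrite ge0_integralD//; last 2 first.
- by move=> x _; rewrite mule_ge0// lee_fin divr_ge0.
- exact: measurable_funeM.
have -> : (\int[Q]__ b%:E = b%:E)%E.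
  transitivity (b%:E * Q setT)%E; first by rewrite integral_cst.
  by rewrite probability_setT mule1.
rewrite ge0_integralZl//; last first.
  by rewrite lee_fin divr_ge0.
apply: lee_wpmul2l; first by rewrite lee_fin.
apply: leeD => //.
have -> : ((F%:E ^+ 2 + (sigma ^+ 2)%:E) / n%:R%:E = (C / n%:R)%:E)%E.
  by rewrite inver gt_eqF// -EFin_expe -EFinD -EFinM.
by apply: lee_wpmul2l => //; rewrite lee_fin divr_ge0.
Qed.
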